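(* Let $\{\varphi_i\}_{i=1}^N$ be an equiangular tight frame in $\mathbb{R}^M$. Then for any $x\in\mathbb{R}^M$ with $\|x\|=1$, $$2\Big(N-\sqrt{N[1+(N-1)c]}\Big)\le\sum_{i=1}^N\|x-\varphi_i\|^2\le 2\Big(N+\sqrt{N[1+(N-1)c]}\Big),$$ where $c:=\sqrt{\frac{N-M}{M(N-1)}}=|\langle\varphi_i,\varphi_j\rangle|$ for all $i\ne j$.
   Context: A family $\{\varphi_i\}_{i=1}^N$ in $\mathbb{R}^M$ is a tight frame if there is a constant $A>0$ with $\sum_{i=1}^N|\langle x,\varphi_i\rangle|^2=A\|x\|^2$ for all $x\in\mathbb{R}^M$. It is equiangular if $\|\varphi_i\|=1$ for all $i$ and there is a constant $d$ with $|\langle\varphi_i,\varphi_j\rangle|=d$ for all $i\ne j$; an equiangular tight frame is a tight frame that is equiangular (in particular unit norm). For an equiangular tight frame of $N$ vectors in dimension $M$ it is known that $|\langle\varphi_i,\varphi_j\rangle|^2=\frac{N-M}{M(N-1)}$ for $i\neq j$. *)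

(* Defs.v *)
From mathcomp Require Import all_boot all_order all_algebra.
From mathcomp Require Import reals.

Set Implicit Arguments.
Unset Strict Implicit.
Unset Printing Implicit Defensive.

Import Order.TTheory GRing.Theory Num.Theory.
Local Open Scope ring_scope.

Definition dot (R : realType) (M : nat) (u v : 'rV[R]_M) : R :=
  \sum_(k < M) u 0 k * v 0 k.

(* The Euclidean norm; needed because the norm `|u| that MathComp-Analysis puts on matrices is the
   sup norm. *)
Definition norm2 (R : realType) (M : nat) (u : 'rV[R]_M) : R :=
  Num.sqrt (dot u u).

Definition tight_frame (R : realType) (M N : nat) (phi : 'I_N -> 'rV[R]_M) :
    Prop :=
  exists2 A : R, 0 < A &
    forall x : 'rV[R]_M,
      \sum_(i < N) `|dot x (phi i)| ^+ 2 = A * norm2 x ^+ 2.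

Definition equiangular (R : realType) (M N : nat) (phi : 'I_N -> 'rV[R]_M) :
    Prop :=
  (forall i, norm2 (phi i) = 1) /\
  exists d : R, forall i j, i != j -> `|dot (phi i) (phi j)| = d.

Definition equiangular_tight_frame (R : realType) (M N : nat)
    (phi : 'I_N -> 'rV[R]_M) : Prop :=
  tight_frame phi /\ equiangular phi.

(* For N = 1 (which forces M = 1) the quotient is 0 / 0, which is 0 in MathComp;
   the constant then only occurs multiplied by N - 1 = 0. *)
Definition etf_coherence (R : realType) (M N : nat) : R :=
  Num.sqrt ((N%:R - M%:R) / (M%:R * (N%:R - 1))).

(* Main.v *)
(** Summing the tight frame identity over the standard basis gives [N = A M], and
    evaluating it at a frame vector gives [1 + (N - 1) d^2 = A]; together they
    determine [d].  For a unit vector [x], the sum of the [|x - phi_i|^2] is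
    [2 N - 2 <x, S>] with [S] the sum of the [phi_i]; Cauchy-Schwarz bounds
    [<x, S>^2] by [|S|^2], the sum of all the entries of the Gram matrix, hence by
    [N + N (N - 1) c]. *)
Require Import Defs.
From mathcomp Require Import all_boot all_order all_algebra.
From mathcomp Require Import reals.
From mathcomp Require Import ring lra.

Import Order.TTheory GRing.Theory Num.Theory.
Local Open Scope ring_scope.

Section Dot.
Context {R : realType} {M : nat}.
Implicit Types u v w x : 'rV[R]_M.

Lemma dotC u v : dot u v = dot v u.
Proof. by apply: eq_bigr => k _; rewrite mulrC. Qed.

Lemma dotBl u v w : dot (u - v) w = dot u w - dot v w.
Proof. by rewrite -sumrB; apply: eq_bigr => k _; rewrite !mxE mulrBl. Qed.

Lemma dotZl a u v : dot (a *: u) v = a * dot u v.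
Proof. by rewrite mulr_sumr; apply: eq_bigr => k _; rewrite mxE mulrA. Qed.

Lemma dot_suml (I : finType) (F : I -> 'rV[R]_M) v :
  dot (\sum_i F i) v = \sum_i dot (F i) v.
Proof.
rewrite exchange_big; apply: eq_bigr => k _.
by rewrite summxE mulr_suml.
Qed.

Lemma dot_ge0 u : 0 <= dot u u.
Proof. by apply: sumr_ge0 => k _; rewrite -expr2 sqr_ge0. Qed.

Lemma norm2_sqr u : norm2 u ^+ 2 = dot u u.
Proof. exact: sqr_sqrtr (dot_ge0 u). Qed.

Lemma norm2_eq1_dot u : norm2 u = 1 -> dot u u = 1.
Proof. by rewrite -norm2_sqr => ->; rewrite expr1n. Qed.

Lemma norm2_sqrB u v : norm2 (u - v) ^+ 2 = dot u u + dot v v - 2 * dot u v.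
Proof.
by rewrite norm2_sqr dotBl ![dot _ (u - v)]dotC !dotBl (dotC v u); ring.
Qed.

(** Cauchy-Schwarz for a unit vector: the residual [v - dot x v *: x] has squared norm
    [dot v v - dot x v ^+ 2], which is nonnegative. *)
Lemma dot_sqr_le x v : dot x x = 1 -> dot x v ^+ 2 <= dot v v.
Proof.
move=> x1; have := dot_ge0 (v - dot x v *: x).
rewrite -norm2_sqr norm2_sqrB [dot v (_ *: _)]dotC !dotZl.
rewrite [dot x (_ *: _)]dotC dotZl x1; nra.
Qed.

Lemma dot_delta_mx k v : dot (delta_mx 0 k) v = v 0 k.
Proof.
rewrite /dot (bigD1 k) //= mxE !eqxx mul1r big1 ?addr0 // => j jk.
by rewrite mxE (negbTE jk) mul0r.
Qed.

End Dot.

Section EquiangularTightFrame.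
Context {R : realType} {M N : nat} (phi : 'I_N -> 'rV[R]_M).

Lemma tight_frame_bound_trace (A : R) :
    (forall i, norm2 (phi i) = 1) ->
    (forall x, \sum_i `|dot x (phi i)| ^+ 2 = A * norm2 x ^+ 2) ->
  N%:R = A * M%:R.
Proof.
move=> unit_phi tf.
have : \sum_(k < M) \sum_i `|dot (delta_mx 0 k) (phi i)| ^+ 2 = A * M%:R.
  under eq_bigr do rewrite tf norm2_sqr dot_delta_mx mxE !eqxx mulr1.
  by rewrite sumr_const card_ord mulr_natr.
(* After the swap, the inner sum over [k] adds the squared coordinates of [phi i], giving 1. *)
rewrite exchange_big /= => <-.
rewrite (eq_bigr (fun=> 1)) ?sumr_const ?card_ord // => i _.
rewrite -(norm2_eq1_dot _ (unit_phi i)); apply: eq_bigr => k _.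
by rewrite dot_delta_mx real_normK ?num_real.
Qed.

(** Serves a row of the Gram matrix twice: with squared entries to find [d], and with absolute
    values to bound [|S|^2]. *)
Lemma sum_off_diag (a b : R) (j : 'I_N) (F : 'I_N -> R) :
  F j = a -> (forall i, i != j -> F i = b) -> \sum_i F i = a + (N%:R - 1) * b.
Proof.
move=> Fj Fi; rewrite (bigD1 j) //= Fj (eq_bigr (fun=> b)) //.
rewrite sumr_const cardC1 card_ord -[_ *+ _]mulr_natl.
(* The index [j] forces [N] to be positive, so the truncated predecessor of [N] casts to
   [N%:R - 1]. *)
by case: N j {F Fj Fi} => [[]//|n] _; rewrite -natr1 addrK.
Qed.

Lemma etf_coherenceE : equiangular_tight_frame phi ->
  forall i j, i != j -> `|dot (phi i) (phi j)| = etf_coherence R M N.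
Proof.
move=> [[A A0 tf] [unit_phi [d dE]]] i j ij; rewrite dE //.
have d0 : 0 <= d by rewrite -(dE i j ij).
have AM := tight_frame_bound_trace A unit_phi tf.
(* Two distinct indices exclude [N = 1], and a unit vector excludes [M = 0], so the quotient has a
   nonzero denominator. *)
have N1 : N%:R - 1 != 0 :> R.
  rewrite subr_eq0 pnatr_eq1; apply: contraNneq ij => N1.
  by apply/eqP; case: N i j N1 => [[]//|n] i j [n0]; subst n; rewrite !ord1.
have M0 : M%:R != 0 :> R.
  rewrite pnatr_eq0; apply/eqP => M0; have := norm2_eq1_dot _ (unit_phi i).
  rewrite /dot big1 => [/esym/eqP|k _]; first by rewrite oner_eq0.
  by have := leq_ltn_trans (leq0n k) (ltn_ord k); rewrite {1}M0.
have : 1 + (N%:R - 1) * d ^+ 2 = A.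
  have := tf (phi j); rewrite unit_phi expr1n mulr1 => <-.
  apply/esym/(sum_off_diag _ _ j); first by rewrite norm2_eq1_dot // normr1 expr1n.
  by move=> k kj; rewrite dE // eq_sym.
move=> dA; rewrite /etf_coherence.
suff -> : (N%:R - M%:R) / (M%:R * (N%:R - 1)) = d ^+ 2 by rewrite sqrtr_sqr ger0_norm.
(* Here [N - M = A M - M = M (A - 1)], and [A - 1 = (N - 1) d^2]. *)
have -> : N%:R - M%:R = M%:R * (N%:R - 1) * d ^+ 2.
  by rewrite {1}AM -dA; ring.
by rewrite mulrC mulKf // mulf_neq0.
Qed.

Lemma dot_sum_le (c : R) :
    (forall i, norm2 (phi i) = 1) ->
    (forall i j, i != j -> `|dot (phi i) (phi j)| = c) ->
  dot (\sum_i phi i) (\sum_i phi i) <= N%:R * (1 + (N%:R - 1) * c).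
Proof.
move=> unit_phi cE; rewrite dot_suml.
(* Each of the [N] Gram rows has diagonal entry 1 and [N - 1] entries of absolute value [c]. *)
suff le_row i : dot (phi i) (\sum_j phi j) <= 1 + (N%:R - 1) * c.
  apply: le_trans (ler_sum _ (fun i _ => le_row i)) _.
  by rewrite sumr_const card_ord mulr_natl.
rewrite dotC dot_suml.
apply: le_trans (ler_sum _ (fun j _ => ler_norm (dot (phi j) (phi i)))) _.
rewrite (sum_off_diag 1 c i) //; first by rewrite norm2_eq1_dot // normr1.
by move=> j ji; rewrite cE.
Qed.

Lemma sum_sqr_dist_unit x :
    (forall i, norm2 (phi i) = 1) -> norm2 x = 1 ->
  \sum_i norm2 (x - phi i) ^+ 2 = 2 * (N%:R - dot x (\sum_i phi i)).
Proof.
move=> unit_phi x1; rewrite dotC dot_suml.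
under eq_bigr do rewrite norm2_sqrB !norm2_eq1_dot // dotC.
by rewrite sumrB -mulr_sumr sumr_const card_ord -mulr_natl; ring.
Qed.

End EquiangularTightFrame.

Theorem proposition6p2 (R : realType) (M N : nat) (phi : 'I_N -> 'rV[R]_M)
    (etf : equiangular_tight_frame phi) :
  let c : R := etf_coherence R M N in
  (forall i j : 'I_N, i != j -> `|dot (phi i) (phi j)| = c) /\
  (forall x : 'rV[R]_M, norm2 x = 1 ->
     2 * (N%:R - Num.sqrt (N%:R * (1 + (N%:R - 1) * c)))
       <= \sum_(i < N) norm2 (x - phi i) ^+ 2
       <= 2 * (N%:R + Num.sqrt (N%:R * (1 + (N%:R - 1) * c)))).
Proof.
move=> c; have cE := etf_coherenceE phi etf; split=> // x x1.
have [_ [unit_phi _]] := etf.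
(* Cancelling the factor 2 and the term [N] merges both inequalities into a bound on the absolute
   value of [dot x (\sum_i phi i)], which is then written as the root of its square. *)
rewrite sum_sqr_dist_unit // !ler_pM2l ?ltr0n // lerD2l lerN2 lerD2l lerNl andbC -ler_norml.
rewrite -sqrtr_sqr ler_wsqrtr //.
exact: le_trans (dot_sqr_le _ _ (norm2_eq1_dot _ x1)) (dot_sum_le _ _ unit_phi cE).
Qed.
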